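(* For every null set $F\subseteq 2^\omega$ there is a splitting tree $T\subseteq 2^{<\omega}$ such that for every $n\in\omega$ the set $$F+\underbrace{[T]+[T]+\dots+[T]}_{n\text{ times}}$$ is null.
   Context: Null means of measure zero with respect to the standard product (Haar) probability measure on $2^\omega$. A tree is a nonempty set $T\subseteq 2^{<\omega}$ closed under initial segments, and $[T]=\{x\in 2^\omega:(\forall n\in\omega)\ x\upharpoonright n\in T\}$. $T$ is a splitting tree if $(\forall\sigma\in T)(\exists N\in\omega)(\forall n>N)(\forall i\in\{0,1\})(\exists\tau\in T)(\sigma\subseteq\tau\ \wedge\ \tau(n)=i)$. On $2^\omega$, $+$ is coordinatewise addition modulo $2$, and $A+B=\{a+b:a\in A,\ b\in B\}$ for $A,B\subseteq 2^\omega$; for $n=0$ the displayed set is read as $F$ itself. *)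

(* Defs.v *)
From HB Require Import structures.
From mathcomp Require Import all_boot all_order all_algebra.
From mathcomp Require Import all_classical all_reals all_analysis.

Set Implicit Arguments.
Unset Strict Implicit.
Unset Printing Implicit Defensive.

Import Order.TTheory GRing.Theory Num.Theory.

Local Open Scope classical_set_scope.
Local Open Scope ring_scope.

Definition determined (n : nat) (A : set cantor_space) :=
  forall x y : cantor_space, (forall i, (i < n)%N -> x i = y i) -> A x -> A y.

Definition cylinder_set : set (set cantor_space) :=
  [set A | exists n, determined n A].

Lemma determinedW m n A : (m <= n)%N -> determined m A -> determined n A.
Proof.
by move=> mn Am x y xy; apply: Am => i im; apply: xy; exact: leq_trans im mn.
Qed.

Lemma determined0 n : determined n set0.
Proof. by []. Qed.

Lemma determinedC n A : determined n A -> determined n (~` A).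
Proof. by move=> An x y xy nAx Ay; apply: nAx; apply: An Ay => i /xy. Qed.

Lemma determinedU n A B :
  determined n A -> determined n B -> determined n (A `|` B).
Proof.
by move=> An Bn x y xy [Ax|Bx]; [left; exact: An Ax|right; exact: Bn Bx].
Qed.

Lemma cylinder_set0 : cylinder_set set0.
Proof. by exists 0%N. Qed.

Lemma cylinder_setC : setC_closed cylinder_set.
Proof. by move=> A [n An]; exists n; exact: determinedC. Qed.

Lemma cylinder_setU : setU_closed cylinder_set.
Proof.
move=> A B [m Am] [n Bn]; exists (maxn m n).
by apply: determinedU; [apply: determinedW Am; exact: leq_maxl|
                        apply: determinedW Bn; exact: leq_maxr].
Qed.

(* On this alias [measurable] is the mere algebra of cylinder sets; the
   [g_sigma_algebraType] over it carries the sigma-algebra. *)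
Definition coin_space : Type := cantor_space.

Definition coin_display : measure_display.
Proof. exact: default_measure_display. Qed.

HB.instance Definition _ := Pointed.on coin_space.
HB.instance Definition _ := @isAlgebraOfSets.Build coin_display coin_space
  cylinder_set cylinder_set0 cylinder_setU cylinder_setC.

Lemma determined_open n A : determined n A -> open A.
Proof.
move=> An; rewrite openE => x Ax.
suff : nbhs x [set y : cantor_space | forall i, (i < n)%N -> x i = y i].
  by apply: filterS => y /= xy; exact: An Ax.
elim: {An} n => [|n IHn]; first exact: filterE.
have : nbhs x [set y : cantor_space | x n = y n].
  have := @proj_continuous _ (fun _ : nat => bool) n x [set b | x n = b].
  by apply; exact/principal_filterP.
move=> {}/(filterI IHn); apply: filterS => y [/= xy xyn] i.
by rewrite ltnS leq_eqVlt => /predU1P[->//|]; exact: xy.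
Qed.

Lemma determined_finite_cover n A (F : nat -> set cantor_space) :
  determined n A -> (forall k, exists m, determined m (F k)) ->
  A `<=` \bigcup_k F k -> exists m, A `<=` \big[setU/set0]_(k < m) F k.
Proof.
move=> An Fd AF.
have cA : compact A.
  apply: (subclosed_compact _ cantor_space_compact) => //.
  by rewrite -openC; apply: determined_open; exact: determinedC An.
move: cA; rewrite compact_cover => /(_ nat setT F)[k _|//|D _ AD].
  by have [m] := Fd k; exact: determined_open.
exists (\max_(i <- finmap.enum_fset D) i).+1 => x /AD[/= i iD Fix].
rewrite -bigcup_mkord; exists i => //=.
by rewrite ltnS; exact: leq_bigmax_seq.
Qed.

Section coin_measure.
Context (R : realType).

Definition extend (s : seq bool) : cantor_space := nth false s.

Definition frequency (n : nat) (A : set cantor_space) : R :=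
  #|[set s : n.-tuple bool | `[< A (extend s) >]]%SET|%:R / 2 ^+ n.

(* The choice of the level is irrelevant by [coin_contentE]. *)
Definition coin_content (A : set coin_space) : \bar R :=
  (frequency (get (fun n => determined n A)) A)%:E.

Lemma frequencyS n A : determined n A -> frequency n.+1 A = frequency n A.
Proof.
move=> An; rewrite /frequency.
pose h (p : n.-tuple bool * bool) := [tuple of rcons p.1 p.2].
have hinj : injective h.
  by move=> [s a] [t b] /(congr1 val) /= /rcons_inj[/val_inj -> ->].
have [g hK gK] : bijective h.
  by apply: inj_card_bij => //; rewrite card_prod !card_tuple card_bool expnSr.
have -> : #|[set s : n.+1.-tuple bool | `[< A (extend s) >]]%SET| =
    #|finset.setX [set s : n.-tuple bool | `[< A (extend s) >]]%SET
        [set: bool]%SET|.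
  rewrite -(card_imset _ hinj); apply: eq_card => t; rewrite -[t]gK.
  rewrite (mem_imset _ _ hinj) !inE andbT; case: (g t) => s b /=.
  have E i : (i < n)%N -> extend (rcons s b) i = extend s i.
    by move=> ni; rewrite /extend nth_rcons size_tuple ni.
  by apply: asbool_equiv_eq; split; apply: An => i /E.
by rewrite cardsX cardsT card_bool natrM exprSr invfM mulrACA divff ?mulr1.
Qed.

Lemma frequency_eq m n A : determined m A -> determined n A ->
  frequency m A = frequency n A.
Proof.
wlog mn : m n / (m <= n)%N.
  move=> H Am An; case/orP: (leq_total m n) => mn; first exact: H.
  by apply/esym; exact: H.
move=> Am _; rewrite -(subnK mn); elim: (n - m)%N => [//|k IHk].
by rewrite addSn frequencyS //; apply: determinedW Am; exact: leq_addl.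
Qed.

Lemma coin_contentE n A : determined n A -> coin_content A = (frequency n A)%:E.
Proof.
move=> An; congr EFin; apply: frequency_eq (An).
exact: (@getPex _ (determined^~ A) (ex_intro _ n An)).
Qed.

Lemma frequencyU n A B : A `&` B = set0 ->
  frequency n (A `|` B) = frequency n A + frequency n B.
Proof.
move=> AB0; rewrite /frequency -mulrDl -natrD -cardsUI.
rewrite [X in (_ + X)%N](_ : _ = 0%N) ?addn0.
  congr (_%:R / _); apply: eq_card => s; rewrite !inE.
  by rewrite asbool_or.
apply/eqP; rewrite cards_eq0; apply/eqP/setP => s; rewrite !inE.
rewrite -asbool_and; apply/asboolP => ABs.
by have : (A `&` B) (extend s) by []; rewrite AB0.
Qed.

Lemma coin_content_ge0 A : (0 <= coin_content A)%E.
Proof. by rewrite lee_fin divr_ge0 // exprn_ge0. Qed.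

Let coin_content_additive : measure_function.semi_additive coin_content.
Proof.
apply/additive2P.
  rewrite (coin_contentE (@determined0 0%N)) /frequency.
  rewrite (_ : [set _ | _]%SET = finset.set0) ?cards0 ?mul0r //.
  by apply/setP => s; rewrite !inE; apply/asboolP.
move=> A B [m Am] [n Bn] AB0.
have {}Am := determinedW (leq_maxl m n) Am.
have {}Bn := determinedW (leq_maxr m n) Bn.
rewrite (coin_contentE (determinedU Am Bn)) (coin_contentE Am).
by rewrite (coin_contentE Bn) frequencyU.
Qed.

HB.instance Definition _ := isContent.Build coin_display coin_space R
  coin_content coin_content_ge0 coin_content_additive.

Let coin_content_sigma_subadditive :
  measurable_subset_sigma_subadditive coin_content.
Proof.
move=> A F mF [n An] AF; have [m AFm] := determined_finite_cover An mF AF.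
apply: (le_trans (content_subadditive coin_content _ _ AFm)) => //.
  by exists n.
rewrite -(big_mkord xpredT (fun k => coin_content (F k))).
by apply: nneseries_lim_ge => k _ _; exact: coin_content_ge0.
Qed.

HB.instance Definition _ := Content_SigmaSubAdditive_isMeasure.Build
  coin_display R coin_space coin_content coin_content_sigma_subadditive.

Definition coin_measure := measure_extension coin_content.

HB.instance Definition _ := Measure.on coin_measure.

Lemma coin_measure_determined n A : determined n A ->
  coin_measure A = (frequency n A)%:E.
Proof.
move=> An; rewrite -(coin_contentE An).
by apply: (measurable_mu_extE coin_content); exists n.
Qed.

Lemma coin_measure_cylinder (s : seq bool) :
  coin_measure [set x : cantor_space | mkseq x (size s) = s] =
  (2^-1 ^+ size s)%:E.
Proof.
rewrite (@coin_measure_determined (size s)) ?/frequency.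
  rewrite (_ : [set _ | _]%SET = [set in_tuple s]%SET) ?cards1.
    by rewrite mul1r exprVn.
  apply/setP => t; rewrite !inE.
  have tE : mkseq (extend t) (size s) = t.
    by rewrite -[X in mkseq _ X](size_tuple t) mkseq_nth.
  apply/asboolP/eqP => /= [ts|->]; last exact: mkseq_nth.
  by apply: val_inj; exact: etrans (esym tE) ts.
move=> x y xy <-; rewrite size_mkseq; apply/esym/eq_in_map => i.
by rewrite mem_iota => /andP[_ /xy].
Qed.

Let coin_measure_setT : coin_measure setT = 1%:E.
Proof.
have := coin_measure_cylinder [::]; rewrite expr0 => <-.
by congr coin_measure; apply/esym/seteqP; split.
Qed.

HB.instance Definition _ := Measure_isProbability.Build _ _ R coin_measure
  coin_measure_setT.

End coin_measure.

Definition null (R : realType) (F : set cantor_space) : Prop :=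
  (@coin_measure R).-negligible F.

Definition cantor_add (x y : cantor_space) : cantor_space :=
  fun n => x n (+) y n.

Definition sumset (A B : set cantor_space) : set cantor_space :=
  [set cantor_add a b | a in A & b in B].

Definition sumset_iter (F B : set cantor_space) (n : nat) : set cantor_space :=
  iter n (fun A => sumset A B) F.

Definition tree (T : set (seq bool)) : Prop :=
  T !=set0 /\ forall s t : seq bool, prefix s t -> T t -> T s.

Definition branches (T : set (seq bool)) : set cantor_space :=
  [set x : cantor_space | forall n, T (mkseq x n)].

(* [onth t n = Some i] says that [n] is in the domain of [t] and [t n = i]. *)
Definition splitting_tree (T : set (seq bool)) : Prop :=
  tree T /\
  forall s, T s -> exists N, forall n, (N < n)%N -> forall i : bool,
    exists t, [/\ T t, prefix s t & onth t n = Some i].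

(* Main.v *)
Require Import Defs.
From mathcomp Require Import all_boot all_order all_algebra.
From mathcomp Require Import all_classical all_reals all_analysis.

Import Order.TTheory GRing.Theory Num.Theory.

Local Open Scope classical_set_scope.

(** Cut the natural numbers into consecutive finite blocks and let [T] be the
    tree of the finite sequences that are constant on each block.  This tree
    splits: a node meets finitely many blocks, and at a position in any other
    block both values remain possible.  Its set of branches is the subgroup
    [G] of the points that are constant on each block, so adding it to [F] any
    number of times gives nothing beyond [F + G], and it remains to choose the
    blocks such that [F + G] is null.

    Since [F] is null, it is contained in the limit superior of a sequence of
    cylinder sets whose measures have a finite sum.  Grouping consecutive terms
    of that sequence along the tails of the series gives cylinder sets [D i]
    whose measures decrease as fast as desired and such that [F] is still
    contained in their limit superior ([null_lim_sup]); take measures at most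
    [4^-(i+1)].  Let [D i] be determined by the coordinates below [m i], and
    choose the blocks so slowly that these coordinates meet at most [i + 1]
    blocks.  Below [m i] the elements of [G] then show at most [2^(i+1)]
    patterns, so [D i + G] is determined by the same coordinates and has measure
    at most [2^(i+1) 4^-(i+1) = 2^-(i+1)]
    ([frequency_sumset_block_constant]).  These measures have a finite sum, and
    [F + G] is contained in the limit superior of the sets [D i + G], so it is
    null by the Borel-Cantelli lemma. *)

(** * Cutting the natural numbers into intervals *)

(** [b n] is the index of the interval that contains [n], when the interval of
    index [i] ends just before [A i]. *)
Lemma exists_block_index (A : nat -> nat) :
  (forall i, A i < A i.+1) ->
  exists b : nat -> nat, forall n i, (b n <= i) = (n < A i).
Proof.
move=> Ainc.
have Amono : {homo A : i j / i <= j}.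
  by apply: homo_leq => [//|? ? ?|i]; [exact: leq_trans|exact/ltnW].
have Age i : i <= A i.
  by elim: i => [//|i IHi]; exact: leq_ltn_trans IHi (Ainc i).
have Aunb n : exists i, n < A i by exists n.+1; exact: Age.
exists (fun n => ex_minn (Aunb n)) => n i.
case: ex_minnP => b nAb bmin; apply/idP/idP => [bi|]; last exact: bmin.
exact: leq_trans nAb (Amono _ _ bi).
Qed.

Lemma exists_increasing_above (N : nat -> nat) :
  exists A : nat -> nat, (forall i, A i < A i.+1) /\ forall i, N i <= A i.
Proof.
exists (fun i => \sum_(j < i.+1) (N j).+1); split=> i.
  by rewrite [ltnRHS]big_ord_recr /= addnS ltnS leq_addr.
by rewrite big_ord_recr /= addnS leqW // leq_addl.
Qed.

(** * Points and sequences that are constant on blocks *)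

Section blocks.
Variable b : nat -> nat.

Definition block_constant : set cantor_space :=
  [set x | forall i j, b i = b j -> x i = x j].

Definition block_tree : set (seq bool) :=
  [set s | forall i j, i < size s -> j < size s -> b i = b j ->
             nth false s i = nth false s j].

Lemma branches_block_tree : branches block_tree = block_constant.
Proof.
apply/seteqP; split=> x /=.
  move=> xT i j bij; have := xT (maxn i j).+1 i j.
  by rewrite size_mkseq !nth_mkseq ?ltnS ?leq_maxl ?leq_maxr //; exact.
move=> xb n i j; rewrite size_mkseq => ni nj bij.
by rewrite !nth_mkseq //; exact: xb.
Qed.

(** The blocks that a node meets have bounded index [K] and lie below [A K], so
    an extension of the node that is constant on blocks can take any value at a
    position beyond [A K]. *)
Lemma splitting_block_tree (A : nat -> nat) :
  (forall n i, (b n <= i) = (n < A i)) -> splitting_tree block_tree.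
Proof.
move=> bA; split.
  split; first by exists [::].
  move=> s t /prefixP[u ->] tT i j is_ js bij.
  have := tT i j; rewrite !nth_cat is_ js size_cat.
  by apply => //; apply: ltn_addr.
move=> s sT; pose K := \max_(j < size s) b j.
exists (A K + size s) => n nN i.
(* [x k] depends on [k] through [b k] only; blocks of index at most [K] that
   [s] does not meet get the value [false]. *)
pose x k : bool :=
  if b k <= K then [exists j : 'I_(size s), (b j == b k) && nth false s j]
  else i.
have xs k : k < size s -> x k = nth false s k.
  move=> ks; rewrite /x (leq_bigmax (Ordinal ks)).
  apply/existsP/idP => [[j /andP[/eqP bjk]]|sk]; last first.
    by exists (Ordinal ks); rewrite eqxx.
  by rewrite (sT j k).
have xb : block_constant x by move=> k l bkl; rewrite /x bkl.
exists (mkseq x n.+1); split.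
- by move: xb; rewrite -branches_block_tree; apply.
- have sn : size s <= n.+1.
    exact: leqW (leq_trans (leq_addl _ _) (ltnW nN)).
  rewrite prefixE; apply/eqP/(@eq_from_nth _ false).
    by rewrite size_takel // size_mkseq.
  move=> k; rewrite size_takel ?size_mkseq // => ks.
  by rewrite nth_take // nth_mkseq ?xs // (leq_trans ks).
- rewrite onthE (nth_map false) ?size_mkseq // nth_mkseq // /x bA.
  by rewrite ltnNge (leq_trans (leq_addr _ _) (ltnW nN)).
Qed.

(** The points constant on blocks form a subgroup, so the sums collapse; the
    inclusion in the case of no summand holds because the subgroup contains
    zero. *)
Lemma sumset_iter_block_constant (F : set cantor_space) n :
  sumset_iter F block_constant n `<=` sumset F block_constant.
Proof.
elim: n => [x Fx|n IHn].
  exists x => //; exists (fun=> false) => //.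
  by apply/funext => i; rewrite /cantor_add addbF.
move=> _ [_ /IHn[x Fx [g gG <-]] [h hG <-]].
exists x => //; exists (cantor_add g h).
  by move=> i j bij; rewrite /cantor_add (gG i j) // (hG i j).
by apply/funext => i; rewrite /cantor_add addbA.
Qed.

Lemma sumset_block_constant_lim_sup (D : nat -> set cantor_space) F :
  F `<=` lim_sup_set D ->
  sumset F block_constant `<=`
    lim_sup_set (fun i => sumset (D i) block_constant).
Proof.
move=> FD _ [x /FD Dx [g gG <-]] n _; have [i ni Dix] := Dx n I.
by exists i => //; exists x => //; exists g.
Qed.

Lemma determined_sumset_block_constant m D :
  determined m D -> determined m (sumset D block_constant).
Proof.
move=> Dm x y xy [d Dd [g gG dgx]]; exists (cantor_add y g).
  apply: Dm Dd => i im; rewrite /cantor_add -xy // -dgx /cantor_add.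
  by rewrite addbK.
by exists g => //; apply/funext => i; rewrite /cantor_add addbK.
Qed.

(** The first [m] coordinates meet at most [p] blocks, so the restriction of a
    point constant on blocks to them is given by [p] bits.  Hence every
    admissible sequence of length [m] for the sumset comes from one for [D] and
    one function from ['I_p] to [bool]. *)
Lemma frequency_sumset_block_constant (R : realType) m p D :
  determined m D -> (forall n, n < m -> b n < p) ->
  (frequency R m (sumset D block_constant) <= 2 ^+ p * frequency R m D)%R.
Proof.
move=> Dm bp; rewrite /frequency mulrA ler_pM2r ?invr_gt0 ?exprn_gt0 //.
rewrite -natrX -natrM ler_nat.
pose h (u : m.-tuple bool * {ffun 'I_p -> bool}) : m.-tuple bool :=
  [tuple tnth u.1 i (+) u.2 (Ordinal (bp i (ltn_ord i))) | i < m].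
pose S := [set s : m.-tuple bool | `[< D (extend s) >]]%SET.
have -> : (2 ^ p * #|S| = #|finset.setX S [set: {ffun 'I_p -> bool}]%SET|)%N.
  by rewrite cardsX cardsT card_ffun card_bool card_ord mulnC.
apply: leq_trans (leq_imset_card h _).
apply/subset_leq_card/fintype.subsetP => t.
rewrite inE => /asboolP[d Dd [g gG dgt]].
(* The bit of block [k] is the common value of [g] there; a block that lies
   beyond [m] gets [false], which [h] never reads. *)
apply/imsetP.
exists ([tuple d i | i < m],
        [ffun k : 'I_p => [exists j : 'I_m, (b j == k) && g j]]).
  rewrite inE /= !inE andbT; apply/asboolP.
  apply: Dm Dd => i im.
  by rewrite /extend -[i in RHS]/(val (Ordinal im)) -tnth_nth tnth_mktuple.
apply: eq_from_tnth => i; rewrite !tnth_mktuple ffunE /=.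
rewrite (tnth_nth false) -[nth _ _ _]/(extend t i) -dgt /cantor_add.
congr addb; apply/idP/existsP => [gi|[j /andP[/eqP bji]]].
  by exists i; rewrite eqxx.
by rewrite (gG j i).
Qed.

End blocks.

(** * Covering a null set infinitely often *)

Section measure.
Variable R : realType.
Local Open Scope ereal_scope.

Lemma nneseries_geometric_lt_pinfty (u : nat -> \bar R) :
  (forall n, 0 <= u n) -> (forall n, u n <= (1 / (2 ^ n.+1)%:R)%:E) ->
  \sum_(n <oo) u n < +oo.
Proof.
move=> u0 ule.
apply: (@le_lt_trans _ _ (\sum_(n <oo) (0 + (1 / (2 ^ n.+1)%:R)%:E))).
  by apply: lee_nneseries => // n _; rewrite add0e.
apply: le_lt_trans (epsilon_trick _ _ _) _ => //.
by rewrite eseries0 // add0e ltry.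
Qed.

Notation mu := (@coin_measure R).

Lemma coin_measure_ge0 (A : set cantor_space) : 0 <= mu A.
Proof. exact: (outer_measure_ge0 (mu_ext (@coin_content R))). Qed.

(** By construction [coin_measure] is an outer measure, so it is monotone on
    arbitrary sets. *)
Lemma coin_measure_le (A B : set cantor_space) : A `<=` B -> mu A <= mu B.
Proof. exact: (le_outer_measure (mu_ext (@coin_content R))). Qed.

(** For every [j] take a cover of [F] by cylinder sets of total measure at most
    [2^-(j+1)], and enumerate all the sets of all these covers in one sequence.
    A point of [F] lies in a set of every cover, hence in infinitely many terms
    of the sequence. *)
Lemma null_cover_lim_sup (F : set cantor_space) : null R F ->
  exists E : nat -> set cantor_space,
    [/\ forall n, cylinder_set (E n), F `<=` lim_sup_set E &
        \sum_(n <oo) mu (E n) < +oo].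
Proof.
move=> [A [_ A0 FA]].
have cover j : exists C : nat -> set cantor_space,
    [/\ forall k, cylinder_set (C k), F `<=` \bigcup_k C k &
        \sum_(k <oo) mu (C k) <= (1 / (2 ^ j.+1)%:R)%:E].
  have e0 : (0 < 1 / (2 ^ j.+1)%:R :> R)%R by [].
  pose S := [set \sum_(k <oo) coin_content R (C k) |
    C in measurable_cover (A : set coin_space)].
  have infS : ereal_inf S = 0 by exact: A0.
  have := @lb_ereal_inf_adherent R S _ e0; rewrite infS.
  move=> /(_ isT)[_ [C [mC AC] <-]].
  rewrite add0e => /ltW Cj; exists C; split => //.
    exact: subset_trans AC.
  apply: le_trans Cj; apply: lee_nneseries => [*|k _].
    exact: coin_measure_ge0.
  by have [m Cm] := mC k; rewrite (coin_measure_determined _ Cm) -coin_contentE.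
have [C /all_and3[mC FC Csum]] := choice cover.
have /card_esym/ppcard_eqP[f] := card_nat2.
exists (fun n => C (f n).1 (f n).2); split=> [n||].
- exact: mC.
- move=> x Fx N _.
  (* A set of the cover [j] cannot be among the first [N] terms when [j] exceeds
     the indices of all covers that occur there. *)
  pose j := (\max_(n < N) (f n).1).+1.
  have [k _ Cjkx] := FC j x Fx.
  have fK : f (f^-1%FUN (j, k)) = (j, k) by rewrite invK ?inE.
  exists (f^-1%FUN (j, k)); last by rewrite /= fK.
  rewrite /= leqNgt; apply/negP => nN.
  have := @leq_bigmax 'I_N (fun n => (f n).1) (Ordinal nN).
  by rewrite /= fK /= ltnn.
- rewrite nneseries_esumT; last by move=> n; exact: coin_measure_ge0.
  rewrite -(reindex_esum setT setT f (fun p => mu (C p.1 p.2))); last first.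
    by exact: (@bij _ _ _ _ f).
  have -> : [set: nat * nat] = [set: nat] `*`` (fun=> [set: nat]).
    by apply/seteqP; split.
  rewrite -(@esum_esum _ _ _ _ _ (fun j k => mu (C j k))) => [|*]; last first.
    exact: coin_measure_ge0.
  under eq_esum => j _.
    rewrite -nneseries_esumT; last by move=> k; exact: coin_measure_ge0.
    over.
  have Cge0 j : 0 <= \sum_(k <oo) mu (C j k).
    by apply: nneseries_ge0 => k _ _; exact: coin_measure_ge0.
  by rewrite -nneseries_esumT //; exact: nneseries_geometric_lt_pinfty.
Qed.

(** With the sets [E n] of the previous lemma, [D i] is the union of the [E n]
    for [n] in an interval [N i, N i.+1): its measure is at most a tail of a
    convergent series, hence small when [N i] is large, and a point in
    infinitely many [E n] lies in infinitely many [D i]. *)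
Lemma null_lim_sup (delta : nat -> R) (F : set cantor_space) :
  (forall i, (0 < delta i)%R) -> null R F ->
  exists D : nat -> set cantor_space,
    [/\ forall i, cylinder_set (D i), F `<=` lim_sup_set D &
        forall i, mu (D i) <= (delta i)%:E].
Proof.
move=> delta0 /null_cover_lim_sup[E [cE FE Esum]].
have tail i : exists N, \sum_(N <= n <oo) mu (E n) <= (delta i)%:E.
  have tail0 : \sum_(N <= n <oo) mu (E n) @[N --> \oo] --> 0.
    by apply: nneseries_tail_cvg => // n _; exact: coin_measure_ge0.
  have nbd : nbhs (0 : \bar R) [set x | x < (delta i)%:E].
    by apply: open_ereal_lt'; rewrite lte_fin.
  have [N _ /(_ N (leqnn N))/ltW Ntail] := tail0 _ nbd.
  by exists N.
have [N0 N0tail] := choice tail.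
have [N [Ninc N0N]] := exists_increasing_above N0.
have [b bN] := exists_block_index _ Ninc.
pose D i := \big[setU/set0]_(n < N i.+1 | (N i <= n)%N) E n.
exists D; split.
- move=> i; apply: big_ind => //; first exact: cylinder_set0.
  exact: cylinder_setU.
- (* The set [D i'] that contains [E n] has [i' = (b n).-1], because the
     interval that starts at [N i'] has index [i'.+1]. *)
  move=> x Fx i _; have [n /= Nin Enx] := FE x Fx (N i) I.
  have ib : (i < b n)%N by rewrite ltnNge bN -leqNgt.
  exists (b n).-1; first by rewrite /= -ltnS prednK // (leq_ltn_trans _ ib).
  have nN : (n < N (b n).-1.+1)%N.
    by rewrite prednK -?bN // (leq_ltn_trans _ ib).
  rewrite /D (bigD1 (Ordinal nN)) /=; first by left.
  by rewrite leqNgt -bN -ltnNge prednK // (leq_ltn_trans _ ib).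
- move=> i; apply: le_trans (N0tail i).
  apply: (@le_trans _ _ (mu (\bigcup_(n in ~` `I_(N0 i)) E n))).
    apply: coin_measure_le => x; rewrite /D.
    elim/big_ind: _ => // [A B AE BE [/AE|/BE]//|n Nin Enx].
    exists n => //=; apply/negP; rewrite -leqNgt.
    exact: leq_trans (N0N i) Nin.
  exact: (outer_measure_sigma_subadditive_tail (mu_ext (@coin_content R))).
Qed.

Lemma null_lim_sup_cylinder (D : nat -> set cantor_space) :
  (forall i, cylinder_set (D i)) ->
  (forall i, mu (D i) <= (1 / (2 ^ i.+1)%:R)%:E) ->
  null R (lim_sup_set D).
Proof.
move=> cD muD; exists (lim_sup_set D).
have mD i : measurable
    (D i : set (g_sigma_algebraType (@measurable _ coin_space))).
  by apply: sub_sigma_algebra; exact: cD.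
split => //.
  by apply: bigcap_measurable => // n _; apply: bigcup_measurable => i _.
apply: lim_sup_set_cvg0 => //.
apply: nneseries_geometric_lt_pinfty => [i|]; last exact: muD.
exact: coin_measure_ge0.
Qed.

(** The blocks end at the bounds [A i], hence are finite; this is what makes the
    tree of the sequences constant on them a splitting tree. *)
Lemma null_sumset_block_constant (F : set cantor_space) : null R F ->
  exists A b : nat -> nat, (forall n i, (b n <= i)%N = (n < A i)%N) /\
    null R (sumset F (block_constant b)).
Proof.
(* The first factor pays for the at most [2^(i+1)] patterns on [i + 1] blocks,
   the second leaves a convergent geometric series. *)
pose delta i : R := ((2 ^+ i.+1)^-1 * (1 / (2 ^ i.+1)%:R))%R.
move=> /(null_lim_sup delta)[i|D [/choice[m mD] FD muD]].
  by rewrite mulr_gt0 // invr_gt0 exprn_gt0.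
have [A [Ainc mA]] := exists_increasing_above m.
have [b bA] := exists_block_index _ Ainc.
exists A, b; split => //.
apply: (@negligibleS _ _ _ mu _ _ (sumset_block_constant_lim_sup b D F FD)).
have cD i := determined_sumset_block_constant b _ _ (mD i).
apply: null_lim_sup_cylinder => i; first by exists (m i); exact: cD.
rewrite (coin_measure_determined _ (cD i)) lee_fin.
have bi n : (n < m i)%N -> (b n < i.+1)%N.
  by move=> nm; rewrite ltnS bA (leq_trans nm).
apply: le_trans (frequency_sumset_block_constant b R _ _ _ (mD i) bi) _.
rewrite -ler_pdivlMl ?exprn_gt0 // -lee_fin.
by rewrite -(coin_measure_determined _ (mD i)); exact: muD.
Qed.

End measure.

(** * Sums of a null set with the branches of a splitting tree *)

Theorem theorem16 (R : realType) (F : set cantor_space) (hF : null R F) :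
  exists T : set (seq bool), splitting_tree T /\
    forall n : nat, null R (sumset_iter F (branches T) n).
Proof.
have [A [b [bA nullFb]]] := null_sumset_block_constant R F hF.
exists (block_tree b); split; first exact: (splitting_block_tree b A).
move=> n; rewrite branches_block_tree.
exact: (@negligibleS _ _ _ (coin_measure R) _ _
  (sumset_iter_block_constant b F n)).
Qed.
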